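(* Let $R$ be a right coherent ring. Then the flat cotorsion pair $(\mathcal{F},\mathcal{C})$ and the Gorenstein flat cotorsion pair $(\mathcal{GF},\mathcal{GC})$ in the category of left $R$-modules have the same core; that is, $\mathcal{GF}\cap\mathcal{GC}=\mathcal{F}\cap\mathcal{C}$.
   Context: Rings have an identity and modules are unital. For a class $\mathcal{S}$ of left $R$-modules, $\mathcal{S}^{\perp}$ is the class of all left $R$-modules $N$ with $\operatorname{Ext}^1_R(S,N)=0$ for all $S\in\mathcal{S}$. $\mathcal{F}$ denotes the class of flat left $R$-modules and $\mathcal{C}=\mathcal{F}^{\perp}$ the class of cotorsion left $R$-modules. A complete flat resolution is an exact chain complex $F=\cdots\to F_1\to F_0\to F_{-1}\to F_{-2}\to\cdots$ of flat left $R$-modules such that $I\otimes_R F$ is exact for every injective right $R$-module $I$. A left $R$-module $M$ is Gorenstein flat if $M=Z_{-1}F=\ker(F_{-1}\to F_{-2})$ for some complete flat resolution $F$. $\mathcal{GF}$ denotes the class of Gorenstein flat left $R$-modules, and $\mathcal{GC}=\mathcal{GF}^{\perp}$ is the class of Gorenstein cotorsion left $R$-modules. The core of a cotorsion pair $(\mathcal{A},\mathcal{B})$ is $\mathcal{A}\cap\mathcal{B}$. *)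

(* Defs.v *)
From HB Require Import structures.
From mathcomp Require Import all_boot all_algebra ring_quotient boolp.
From mathcomp Require Import freeg.

Set Implicit Arguments.
Unset Strict Implicit.
Unset Printing Implicit Defensive.

Import GRing.Theory.
Local Open Scope ring_scope.
Local Open Scope quotient_scope.

(* A left R-module is an [lmodType R]; a right R-module is a left module over
   the converse ring, i.e. an [lmodType R^c], where [r *: a] stands for a r.  *)

Definition surj (A B : Type) (f : A -> B) : Prop :=
  forall y, exists x, f x = y.

Definition exact_at (A B : Type) (C : zmodType) (f : A -> B) (g : B -> C) :
    Prop :=
  forall y, g y = 0 <-> exists x, f x = y.

Section Tensor.
Variables (R : pzRingType) (A : lmodType R^c) (M : lmodType R).

Definition free_ab : zmodType := {freeg (A * M)%type / int}.

Definition free_gen (a : A) (m : M) : free_ab := << (a, m) >>.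

(* The subgroup generated by the relations of R-balanced biadditivity. *)
Inductive tensor_rel : free_ab -> Prop :=
| tensor_rel0 : tensor_rel 0
| tensor_relB x y : tensor_rel x -> tensor_rel y -> tensor_rel (x - y)
| tensor_relDl a a' m :
    tensor_rel (free_gen (a + a') m - (free_gen a m + free_gen a' m))
| tensor_relDr a m m' :
    tensor_rel (free_gen a (m + m') - (free_gen a m + free_gen a m'))
| tensor_relZ (r : R) a m :
    tensor_rel (free_gen ((r : R^c) *: a) m - free_gen a (r *: m)).

Definition tensor_pred : {pred free_ab} := fun x => `[< tensor_rel x >].

Fact tensor_pred_zmod_closed : zmod_closed tensor_pred.
Proof.
split=> [|x y /asboolP rx /asboolP ry]; apply/asboolP.
  exact: tensor_rel0.
exact: tensor_relB.
Qed.

HB.instance Definition _ :=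
  GRing.isZmodClosed.Build free_ab tensor_pred tensor_pred_zmod_closed.

Definition tensor : zmodType := Quotient.quot tensor_pred.

Definition tensor_pi (x : free_ab) : tensor :=
  \pi_(Quotient.quot tensor_pred) x.

Definition tensor_mk (a : A) (m : M) : tensor := tensor_pi (free_gen a m).

Lemma tensor_piB x y : tensor_pi (x - y) = tensor_pi x - tensor_pi y.
Proof. exact: (raddfB \pi_(Quotient.quot tensor_pred)). Qed.

Lemma tensor_piP x y : tensor_pi x = tensor_pi y <-> tensor_rel (x - y).
Proof.
have E := Quotient.idealrBE tensor_pred x y.
split=> [exy|/asboolP rxy]; last by apply/eqP; rewrite -E.
by apply/asboolP; have := E; rewrite (introT eqP exy).
Qed.

Lemma tensor_pi_repr (t : tensor) : exists x, tensor_pi x = t.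
Proof.
by exists (repr (t : Quotient.quot tensor_pred)); rewrite /tensor_pi reprK.
Qed.

End Tensor.

Section TensorMap.
Variables (R : pzRingType) (A B : lmodType R^c) (M N : lmodType R).
Variables (f : {linear A -> B}) (g : {linear M -> N}).

Definition free_ab_map (x : free_ab A M) : free_ab B N :=
  fglift (fun am : A * M => free_gen (f am.1) (g am.2) : {freeg (B * N)%type / int})
    x.

(* The map induced by f and g; [tensor_mapE] shows that it does not depend on
   the representative used here. *)
Definition tensor_map (t : tensor A M) : tensor B N :=
  tensor_pi (free_ab_map (repr (t : Quotient.quot (@tensor_pred R A M)))).

Lemma free_ab_mapB x y :
  free_ab_map (x - y) = free_ab_map x - free_ab_map y.
Proof. exact: lift_is_additive. Qed.

Lemma free_ab_map_gen a m :
  free_ab_map (free_gen a m) = free_gen (f a) (g m).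
Proof. by rewrite /free_ab_map liftU scale1r. Qed.

Lemma free_ab_map_rel x : tensor_rel x -> tensor_rel (free_ab_map x).
Proof.
have D u v : free_ab_map (u + v) = free_ab_map u + free_ab_map v.
  have h0 : free_ab_map 0 = 0 by rewrite -(subrr 0) free_ab_mapB subrr.
  by rewrite -{1}[v]opprK free_ab_mapB -[- v]sub0r free_ab_mapB h0 sub0r opprK.
elim=> [|{}x y _ rx _ ry|a a' m|a m m'|r a m]; rewrite ?free_ab_mapB ?D.
- by rewrite -(subrr 0) free_ab_mapB subrr; exact: tensor_rel0.
- exact: tensor_relB.
- by rewrite !free_ab_map_gen linearD; exact: tensor_relDl.
- by rewrite !free_ab_map_gen linearD; exact: tensor_relDr.
- by rewrite !free_ab_map_gen !linearZ; exact: tensor_relZ.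
Qed.

Lemma tensor_map_pi x : tensor_map (tensor_pi x) = tensor_pi (free_ab_map x).
Proof.
apply/tensor_piP; rewrite -free_ab_mapB; apply: free_ab_map_rel.
by apply/tensor_piP; rewrite /tensor_pi reprK.
Qed.

Lemma tensor_mapB t u : tensor_map (t - u) = tensor_map t - tensor_map u.
Proof.
have [x <-] := tensor_pi_repr t; have [y <-] := tensor_pi_repr u.
by rewrite -tensor_piB !tensor_map_pi free_ab_mapB tensor_piB.
Qed.

Lemma tensor_mapE a m :
  tensor_map (tensor_mk a m) = tensor_mk (f a) (g m).
Proof. by rewrite /tensor_mk tensor_map_pi free_ab_map_gen. Qed.

End TensorMap.

Section Modules.
Variable R : pzRingType.

Definition fin_generated (M : lmodType R) : Prop :=
  exists (n : nat) (p : {linear 'rV[R]_n -> M}), surj p.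

Definition fin_presented (M : lmodType R) : Prop :=
  exists (m n : nat) (q : {linear 'rV[R]_m -> 'rV[R]_n})
         (p : {linear 'rV[R]_n -> M}), exact_at q p /\ surj p.

Definition injective_module (I : lmodType R) : Prop :=
  forall (A B : lmodType R) (i : {linear A -> B}), injective i ->
  forall f : {linear A -> I}, exists g : {linear B -> I}, forall x, g (i x) = f x.

Definition projective_module (P : lmodType R) : Prop :=
  forall (A B : lmodType R) (p : {linear A -> B}), surj p ->
  forall f : {linear P -> B}, exists g : {linear P -> A}, forall x, p (g x) = f x.

Record proj_resolution (S : lmodType R) := ProjResolution {
  pr_obj : nat -> lmodType R;
  pr_diff : forall n, {linear pr_obj n.+1 -> pr_obj n};
  pr_aug : {linear pr_obj 0 -> S};
  pr_proj : forall n, projective_module (pr_obj n);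
  pr_aug_surj : surj pr_aug;
  pr_exact0 : exact_at (pr_diff 0) pr_aug;
  pr_exact : forall n, exact_at (pr_diff n.+1) (pr_diff n)
}.

(* Ext^1_R(S, N) = H^1(Hom_R(P, N)) = 0: every 1-cocycle of Hom_R(P, N) is a
   coboundary.  This does not depend on the projective resolution P of S. *)
Definition Ext1_eq0 (S N : lmodType R) : Prop :=
  forall (P : proj_resolution S) (f : {linear pr_obj P 1 -> N}),
    (forall x, f (pr_diff P 1 x) = 0) ->
  exists g : {linear pr_obj P 0 -> N}, forall x, g (pr_diff P 0 x) = f x.

Definition right_perp (A : lmodType R -> Prop) (N : lmodType R) : Prop :=
  forall S : lmodType R, A S -> Ext1_eq0 S N.

(* The core of a cotorsion pair (A, B). *)
Definition core (A B : lmodType R -> Prop) (M : lmodType R) : Prop :=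
  A M /\ B M.

End Modules.

Section GorensteinFlat.
Variable R : pzRingType.

Definition flat (M : lmodType R) : Prop :=
  forall (A B : lmodType R^c) (i : {linear A -> B}), injective i ->
  injective (tensor_map i (idfun : {linear M -> M})).

Definition cotorsion : lmodType R -> Prop := right_perp flat.

(* The differential leaving F_(n+1) is [cfr_diff n], so that exactness at
   F_(n+1) for all n in Z is exactness everywhere. *)
Record complete_flat_resolution := CompleteFlatResolution {
  cfr_obj : int -> lmodType R;
  cfr_diff : forall n : int, {linear cfr_obj (n + 1) -> cfr_obj n};
  cfr_flat : forall n, flat (cfr_obj n);
  cfr_exact : forall n, exact_at (cfr_diff (n + 1)) (cfr_diff n);
  cfr_tensor_exact : forall I : lmodType R^c, injective_module I -> forall n,
    exact_at (tensor_map (idfun : {linear I -> I}) (cfr_diff (n + 1)))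
             (tensor_map (idfun : {linear I -> I}) (cfr_diff n))
}.

(* M is isomorphic to Z_(-1) F = ker (F_(-1) -> F_(-2)); note that
   -2 + 1 computes to -1. *)
Definition gorenstein_flat (M : lmodType R) : Prop :=
  exists (F : complete_flat_resolution)
         (j : {linear M -> cfr_obj F (-2 + 1)}),
    injective j /\ exact_at j (cfr_diff F (-2)).

Definition gorenstein_cotorsion : lmodType R -> Prop :=
  right_perp gorenstein_flat.

End GorensteinFlat.

(* Right ideals of R are given by monomorphisms J -> R_R of right modules. *)
Definition right_coherent (R : pzRingType) : Prop :=
  forall (J : lmodType R^c) (i : {linear J -> R^c^o}),
  injective i -> fin_generated J -> fin_presented J.

(* Main.v *)
From HB Require Import structures.
From mathcomp Require Import all_boot all_order all_algebra.
From mathcomp Require Import ring_quotient boolp classical_sets functions.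
From mathcomp Require Import freeg.
Require Import Defs.

(** Why the two cores agree.

    Write D = Q/Z, and X^+ = Hom_Z(X, D) for the character module of X, which
    exchanges left and right modules ([rchar], [lchar]).  As D is an injective
    cogenerator of abelian groups ([char_extension], [char_separation]) and
    characters of a tensor product A (x) M are the linear maps from A to M^+,
    a left module M is flat if and only if M^+ is injective
    ([flat_rchar_injective], [rchar_injective_flat]).

    Let M be Gorenstein flat and Gorenstein cotorsion.  A complete flat
    resolution embeds M in a flat module with a Gorenstein flat cokernel
    ([gorenstein_flat_cosyzygy]).  Ext^1 of that cokernel with M vanishes, so
    the embedding splits ([Ext1_eq0_split]) and M is a retract of a flat
    module.  Flat modules being Gorenstein flat ([flat_gorenstein_flat]), M is
    also cotorsion.

    Let M be flat and cotorsion.  Then M is a retract of I^+ for the injective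
    right module I = M^+, and Ext^1(G, M) is a retract of Ext^1(G, I^+), which
    vanishes for every Gorenstein flat G.  This rests on three facts.
    - Over a right coherent ring, I^+ is flat whenever I is injective
      ([coherent_lchar_flat]): a finitely generated right ideal is finitely
      presented, and a linear relation over it with values in I^+ is a
      consequence of its finitely many generating relations.
    - The evaluation M -> M^(++) has a flat cokernel
      ([bidual_cokernel_flat]), since its transpose M^(+++) -> M^+ is split by
      the evaluation of M^+.  Hence it splits when M is cotorsion.
    - Ext^1(G, I^+) is dual to Tor_1(I, G), which vanishes for G Gorenstein
      flat and I injective because I (x) F is exact for a complete flat
      resolution F ([gorenstein_flat_Ext_lchar]). *)

Set Implicit Arguments.
Unset Strict Implicit.
Unset Printing Implicit Defensive.

Import GRing.Theory.
Local Open Scope ring_scope.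

(** * Linear maps from relations, and Baer's criterion *)

Section Relations.
Variable S : pzRingType.

Definition mk_linear (A B : lmodType S) (f : A -> B) (lin_f : linear f) :
  {linear A -> B} := HB.pack f (GRing.isLinear.Build S A B *:%R f lin_f).

Definition mk_additive (A B : zmodType) (f : A -> B) (add_f : zmod_morphism f) :
  {additive A -> B} := HB.pack f (GRing.isZmodMorphism.Build A B f add_f).

(** Most maps below are given by a choice that is unique only afterwards: a lift
    along a surjection, a value of a maximal partial map, a corrected extension.
    Describing their graph reduces linearity to the linearity of a relation. *)
Lemma linear_of_rel (A B : lmodType S) (G : A -> B -> Prop) :
    (forall r x x' y y', G x y -> G x' y' -> G (r *: x + x') (r *: y + y')) ->
    (forall x, exists y, G x y) -> (forall y, G 0 y -> y = 0) ->
  exists f : {linear A -> B}, forall x, G x (f x).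
Proof.
move=> linG totG funG.
have uniqG x y y' : G x y -> G x y' -> y = y'.
  move=> gy gy'; apply/eqP; rewrite -subr_eq0; apply/eqP/funG.
  by have := linG (-1) _ _ _ _ gy' gy; rewrite !scaleN1r addNr addrC.
have [f Gf] := choice totG.
suff lin_f : linear f by exists (mk_linear lin_f).
by move=> r x y; apply: uniqG (Gf _) _; apply: linG.
Qed.

Lemma linear_descend (A B C : lmodType S) (p : {linear A -> B})
    (f : {linear A -> C}) :
    surj p -> (forall a, p a = 0 -> f a = 0) ->
  exists g : {linear B -> C}, forall a, g (p a) = f a.
Proof.
move=> sp kf.
have [|b|c [a [pa <-]]|g gP] :=
  @linear_of_rel _ _ (fun b c => exists a, p a = b /\ f a = c).
- move=> r _ _ _ _ [a [<- <-]] [a' [<- <-]].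
  by exists (r *: a + a'); rewrite !linearP.
- by have [a <-] := sp b; exists (f a), a.
- exact: kf.
exists g => a; have [a' [/eqP]] := gP (p a).
rewrite -subr_eq0 -linearB => /eqP/kf/eqP.
by rewrite linearB subr_eq0 => /eqP <-.
Qed.

Lemma linear_corestrict (A B C : lmodType S) (f : {linear A -> C})
    (j : {linear B -> C}) :
    injective j -> (forall a, exists b, j b = f a) ->
  exists g : {linear A -> B}, forall a, j (g a) = f a.
Proof.
move=> inj_j jf.
apply: (linear_of_rel (G := fun a b => j b = f a)) => // [r a a' b b' E E'|b].
  by rewrite !linearP E E'.
by rewrite linear0 -(linear0 j) => /inj_j.
Qed.

(** The extension property for the left ideals J of S; a linear map J -> I is
    encoded as a function on S subject to conditions on J only. *)
Definition baer_property (I : lmodType S) : Prop :=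
  forall (J : S -> Prop) (h : S -> I), J 0 ->
    (forall a r s, J r -> J s -> J (a * r + s)) ->
    (forall a r s, J r -> J s -> h (a * r + s) = a *: h r + h s) ->
  exists c, forall r, J r -> h r = r *: c.

Section Baer.
Variables (I A B : lmodType S) (f : {linear A -> B}) (phi : {linear A -> I}).
Hypotheses (baerI : baer_property I) (kphi : forall a, f a = 0 -> phi a = 0).

(** A partial map on B is recorded by what its graph adds to the graph of
    f a |-> phi a, so that the empty set, the union of the empty chain in
    Zorn's lemma, is one. *)
Let grow (G : set (B * I)) : set (B * I) :=
  fun p => G p \/ exists a, p = (f a, phi a).

Definition partial_hom (G : set (B * I)) : Prop :=
  (forall r p q, grow G p -> grow G q -> grow G (r *: p + q)) /\
  (forall y, grow G (0, y) -> y = 0).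

Lemma partial_hom0 : partial_hom set0.
Proof.
split=> [r p q [//|[a ->]] [//|[a' ->]]|y [//|[a [e ->]]]]; last exact: kphi.
by right; exists (r *: a + a'); rewrite !linearP.
Qed.

Lemma partial_hom_maximal :
  exists G, partial_hom G /\ forall G', (G `<` G')%classic -> ~ partial_hom G'.
Proof.
apply: Zorn_bigcup => F FP totF.
set U := (X in partial_hom X).
have common p q : grow U p -> grow U q ->
    exists X, [/\ partial_hom X, grow X p, grow X q
                & forall z, grow X z -> grow U z].
  have sub X : F X -> forall z, grow X z -> grow U z.
    by move=> FX z [Xz|]; [left; exists X | right].
  move=> [[X FX Xp]|gp] [[Y FY Yq]|gq].
  - have [XY|YX] := totF _ _ FX FY.
    + by exists Y; split; [exact: FP|left; exact: XY|left|exact: sub].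
    + by exists X; split; [exact: FP|left|left; exact: YX|exact: sub].
  - by exists X; split; [exact: FP|left|right|exact: sub].
  - by exists Y; split; [exact: FP|right|left|exact: sub].
  - exists set0; split; [exact: partial_hom0|by right|by right|].
    by move=> z [//|]; right.
split=> [r p q Up Uq|y Uy].
  by have [X [[linX _] Xp Xq sX]] := common _ _ Up Uq; exact/sX/linX.
by have [X [[_ funX] Xy _ _]] := common _ _ Uy Uy; exact: funX.
Qed.

(** In place of an inclusion, f is any map whose kernel phi kills; this is the
    injectivity of I for the image of f, without forming that image. *)
Theorem baer_extension :
  exists psi : {linear B -> I}, forall a, psi (f a) = phi a.
Proof.
have [G [[linG funG] maxG]] := partial_hom_maximal.
have grow0 : grow G 0 by right; exists 0; rewrite !linear0.
have uniqG x y y' : grow G (x, y) -> grow G (x, y') -> y = y'.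
  move=> gy gy'; apply/eqP; rewrite -subr_eq0; apply/eqP/funG.
  rewrite -(subrr x) -[(_, _)]/((x, y) - (x, y')) addrC -scaleN1r.
  exact: linG.
have tot b : exists y, grow G (b, y).
  apply: contrapT => nb.
  pose J r := exists y, grow G (r *: b, y).
  have valJ r : exists y, J r -> grow G (r *: b, y).
    by have [[y Gy]|nJ] := pselect (J r); [exists y | exists 0 => /nJ].
  have [h hP] := choice valJ.
  have Jlin a r s : J r -> J s -> grow G ((a * r + s) *: b, a *: h r + h s).
    move=> /hP Gr /hP Gs; have := linG a _ _ Gr Gs.
    by rewrite scalerDl -scalerA.
  (* J is the ideal of the r for which r *: b is already in the domain; the
     value c at b is forced on J, and Baer's property provides one. *)
  have [|||c hc] := @baerI J h.
  - by exists 0; rewrite scale0r.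
  - by move=> a r s Jr Js; exists (a *: h r + h s); apply: Jlin.
  - move=> a r s Jr Js; apply: uniqG (Jlin _ _ _ Jr Js).
    by apply: hP; exists (a *: h r + h s); apply: Jlin.
  pose G' : set (B * I) := fun p => exists r q, grow G q /\ p = r *: (b, c) + q.
  have growG' p : grow G' p <-> G' p.
    split=> [[//|gp]|]; last by left.
    by exists 0, p; rewrite scale0r add0r; split=> //; right.
  apply: (maxG G'); first split.
  - by move=> p Gp; exists 0, p; rewrite scale0r add0r; split=> //; left.
  - move=> sub; apply: nb; exists c; left; apply: sub.
    by exists 1, 0; rewrite scale1r addr0.
  - split=> [r p q /growG' [s [p' [Gp ->]]] /growG' [t [q' [Gq ->]]]|y].
      apply/growG'; exists (r * s + t), (r *: p' + q').
      split; first exact: linG.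
      by rewrite scalerDr scalerA addrACA -scalerDl.
    move=> /growG' [r [[x z] [Gq [e ->]]]].
    have Gr : grow G (r *: b, - z).
      have := linG (-1) _ _ Gq grow0; rewrite addr0 scaleN1r.
      suff -> : - (x, z) = (r *: b, - z) by [].
      rewrite /GRing.opp /=; congr (_, _).
      by apply/eqP; rewrite eq_sym -addr_eq0 -e.
    have Jr : J r by exists (- z).
    by rewrite -hc // (uniqG _ _ _ (hP _ Jr) Gr) addNr.
have [|psi psiP] := @linear_of_rel B I (fun x y => grow G (x, y)) _ tot funG.
  by move=> r x x' y y'; apply: linG.
exists psi => a; apply: uniqG (psiP _) _.
by right; exists a.
Qed.

End Baer.
End Relations.

(** * The injective cogenerator Q/Z *)

Lemma int_subgroup_principal (J : int -> Prop) :
    J 0 -> (forall a r s, J r -> J s -> J (a * r + s)) ->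
  exists2 d, J d & forall r, J r -> exists k, r = k * d.
Proof.
move=> J0 linJ.
have [[m Jm]|noJ] := pselect (exists n : nat, J n.+1%:Z); last first.
  exists 0 => // [[[|n]|n] Jr]; first by exists 0; rewrite mulr0.
    by case: noJ; exists n.
  case: noJ; exists n; have := linJ (-1) _ _ Jr J0.
  by rewrite addr0 mulN1r NegzE opprK.
have ex : exists n, `[< J n.+1%:Z >] by exists m; apply/asboolP.
case: (ex_minnP ex) => d /asboolP Jd mind; exists d.+1%:Z => // r Jr.
exists (r %/ d.+1)%Z; rewrite [LHS](divz_eq r d.+1%:Z).
have Jmod : J (r %% d.+1)%Z.
  have := linJ (- (r %/ d.+1)%Z) _ _ Jd Jr.
  by rewrite {2}(divz_eq r d.+1%:Z) mulNr addKr.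
have := modz_ge0 r (isT : d.+1%:Z != 0).
have := ltz_pmod r (isT : (0 < d.+1%:Z)%R).
case: (r %% d.+1)%Z Jmod => [[|n]|n] // Jmod; first by rewrite addr0.
rewrite ltz_nat ltnS => lt_nd _.
by have := mind n (asboolT Jmod); rewrite leqNgt lt_nd.
Qed.

Definition rat_int : {pred rat} := fun x => x \is a Num.int.

Fact rat_int_zmod_closed : zmod_closed rat_int.
Proof. by split=> [|x y]; [exact: rpred0 | exact: rpredB]. Qed.

HB.instance Definition _ :=
  GRing.isZmodClosed.Build rat rat_int rat_int_zmod_closed.

Definition QZ : zmodType := Quotient.quot rat_int.

Definition QZ_class (x : rat) : QZ :=
  (\pi_(Quotient.quot rat_int) x)%qT.

Lemma QZ_class_is_zmod_morphism : zmod_morphism QZ_class.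
Proof. exact: raddfB. Qed.

HB.instance Definition _ :=
  GRing.isZmodMorphism.Build rat QZ QZ_class QZ_class_is_zmod_morphism.

Lemma QZ_class_surj : surj QZ_class.
Proof. by move=> y; exists (repr y); apply: reprK. Qed.

Lemma QZ_class_eq0 x : (QZ_class x == 0) = (x \is a Num.int).
Proof.
rewrite -(raddf0 QZ_class); have := Quotient.idealrBE rat_int x 0.
by rewrite subr0.
Qed.

Lemma QZ_divisible (d : int) (x : QZ) : d != 0 -> exists y, y *~ d = x.
Proof.
move=> nz_d; have [q <-] := QZ_class_surj x; exists (QZ_class (q / d%:~R)).
by rewrite -raddfMz -mulrzr divfK // intr_eq0.
Qed.

(** Subgroups of the integers are cyclic, so only divisibility is at stake. *)
Lemma QZ_baer : baer_property (zmodule QZ).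
Proof.
move=> J h J0 linJ linh; have [d Jd dP] := int_subgroup_principal J0 linJ.
have h0 : h 0 = 0.
  have := linh 1 0 0 J0 J0; rewrite mulr0 addr0 scale1r.
  by move/esym/(canRL (addrK _)); rewrite subrr.
have hd k : h (k * d) = k *: h d.
  by have := linh k _ _ Jd J0; rewrite addr0 h0 addr0.
have [d0|nz_d] := eqVneq d 0.
  by exists 0 => r /dP[k ->]; rewrite d0 mulr0 h0 scaler0.
have [c cP] := QZ_divisible (h d) nz_d.
exists c => r /dP[k ->]; rewrite hd -scalerA; congr (_ *: _).
exact/esym.
Qed.


Lemma char_extension (A B : zmodType) (f : {additive A -> B})
    (phi : {additive A -> QZ}) :
  (forall a, f a = 0 -> phi a = 0) ->
  exists psi : {additive B -> QZ}, forall a, psi (f a) = phi a.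
Proof.
move=> kphi.
have lin_f : linear (f : zmodule A -> zmodule B).
  by move=> n x y; rewrite raddfD raddfMz.
have lin_phi : linear (phi : zmodule A -> zmodule QZ).
  by move=> n x y; rewrite raddfD raddfMz.
have [|psi psiP] :=
  @baer_extension _ _ _ _ (mk_linear lin_f) (mk_linear lin_phi) QZ_baer.
  exact: kphi.
have add_psi : zmod_morphism (psi : B -> QZ) by move=> x y; exact: (raddfB psi).
by exists (mk_additive add_psi).
Qed.

Lemma char_separation (A : zmodType) (v : A) :
  v != 0 -> exists chi : {additive A -> QZ}, chi v != 0.
Proof.
move=> nz_v.
have [|a r s vr vs|d vd dP] := @int_subgroup_principal (fun n => v *~ n = 0).
- exact: mulr0z.
- by rewrite mulrzDr mulrC mulrzA vr vs mul0rz addr0.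
(* The order of v, or 2 when v has infinite order: any integer that is neither
   zero nor a unit would do in that case. *)
pose m := if d == 0 then 2 else d.
have m0 : m != 0 by rewrite /m; case: (eqVneq d 0).
have m_nunit : m \isn't a GRing.unit.
  rewrite /m; case: eqP => // _; apply: contra nz_v => /unitrPr[k kd].
  by rewrite -[v]mulr1z -kd mulrzA vd mul0rz.
have mP r : v *~ r = 0 -> exists k, r = k * m.
  move=> /dP[k ->]; rewrite /m; case: eqP => [->|_]; last by exists k.
  by exists 0; rewrite mul0r mulr0.
pose c := QZ_class (m%:~R^-1).
have add_v : zmod_morphism (fun n : int => v *~ n).
  by move=> x y; rewrite mulrzBr.
have add_c : zmod_morphism (fun n : int => c *~ n).
  by move=> x y; rewrite mulrzBr.
have [n|psi psiP] :=
  @char_extension int A (mk_additive add_v) (mk_additive add_c).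
  move=> /mP[k ->] /=; rewrite /c -raddfMz; apply/eqP; rewrite QZ_class_eq0.
  rewrite -mulrzr mulrC rmorphM mulfK ?intr_eq0 //.
  exact: Num.Theory.intr_int.
exists psi; have := psiP 1; rewrite /= !mulr1z => ->; rewrite QZ_class_eq0.
apply: contra m_nunit => /Num.Theory.intrP[k kP].
apply/unitrPr; exists k; apply: (@intr_inj rat).
by rewrite intrM -kP mulfV // intr_eq0.
Qed.

(** * Character modules, tensor products and Lambek's theorem *)

Section CharacterGroup.
Variable M : zmodType.

Definition char : Type := {additive M -> QZ}.

(** The identity, as a coercion: elements of the type [char M], which carries
    the group structure, have to be usable as functions. *)
Definition char_fun (chi : char) : {additive M -> QZ} := chi.
Coercion char_fun : char >-> Algebra.Additive.type.

Lemma charP (f g : char) : (forall x, f x = g x) -> f = g.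
Proof.
case: f g => [f [[fP]]] [g [[gP]]] /= /funext efg; case: _ / efg gP => gP.
by rewrite (Prop_irrelevance fP gP).
Qed.

HB.instance Definition _ := gen_eqMixin char.
HB.instance Definition _ := gen_choiceMixin char.

Definition char_zero : char := Algebra.Additive.clone M QZ \0 _.
Definition char_add (f g : char) : char := 
  Algebra.Additive.clone M QZ (char_fun f \+ char_fun g) _.
Definition char_opp (f : char) : char := 
  Algebra.Additive.clone M QZ (\- char_fun f) _.

Fact char_addA : associative char_add.
Proof. by move=> f g h; apply: charP => x /=; rewrite addrA. Qed.
Fact char_addC : commutative char_add.
Proof. by move=> f g; apply: charP => x /=; rewrite addrC. Qed.
Fact char_add0 : left_id char_zero char_add.
Proof. by move=> f; apply: charP => x /=; rewrite add0r. Qed.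
Fact char_addN : left_inverse char_zero char_opp char_add.
Proof. by move=> f; apply: charP => x /=; rewrite addNr. Qed.

HB.instance Definition _ :=
  GRing.isZmodule.Build char char_addA char_addC char_add0 char_addN.

Lemma charDE (f g : char) x : (f + g) x = f x + g x. Proof. by []. Qed.
Lemma charNE (f : char) x : (- f) x = - f x. Proof. by []. Qed.

End CharacterGroup.

Section CharacterModule.
Variable R : pzRingType.

(** The same group of characters carries a right or a left action according to
    the side of the module, hence two names for it. *)
Definition rchar (M : lmodType R) : Type := char M.
Definition lchar (A : lmodType R^c) : Type := char A.

HB.instance Definition _ (M : lmodType R) := GRing.Zmodule.on (rchar M).
HB.instance Definition _ (A : lmodType R^c) := GRing.Zmodule.on (lchar A).

Section Right.
Variable M : lmodType R.

Fact rchar_scale_is_zmod_morphism (r : R) (chi : rchar M) :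
  zmod_morphism (fun m => chi (r *: m)).
Proof. by move=> x y; rewrite scalerBr raddfB. Qed.

Definition rchar_scale (r : R^c) (chi : rchar M) : rchar M :=
  mk_additive (rchar_scale_is_zmod_morphism r chi).

Fact rchar_scaleA (a b : R^c) chi :
  rchar_scale a (rchar_scale b chi) = rchar_scale (a * b) chi.
Proof. by apply: charP => m; rewrite /= scalerA. Qed.
Fact rchar_scale1 : left_id 1 rchar_scale.
Proof. by move=> chi; apply: charP => m; rewrite /= scale1r. Qed.
Fact rchar_scaleDr : right_distributive rchar_scale +%R.
Proof. by move=> a f g; apply: charP. Qed.
Fact rchar_scaleDl chi : {morph rchar_scale^~ chi : a b / a + b}.
Proof. by move=> a b; apply: charP => m; rewrite /= scalerDl raddfD. Qed.

HB.instance Definition _ := GRing.Zmodule_isLmodule.Build R^c (rchar M)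
  rchar_scaleA rchar_scale1 rchar_scaleDr rchar_scaleDl.

Lemma rcharZE (r : R^c) (chi : rchar M) m : (r *: chi) m = chi ((r : R) *: m).
Proof. by []. Qed.

End Right.

Section Left.
Variable A : lmodType R^c.

Fact lchar_scale_is_zmod_morphism (r : R) (chi : lchar A) :
  zmod_morphism (fun a => chi ((r : R^c) *: a)).
Proof. by move=> x y; rewrite scalerBr raddfB. Qed.

Definition lchar_scale (r : R) (chi : lchar A) : lchar A :=
  mk_additive (lchar_scale_is_zmod_morphism r chi).

Fact lchar_scaleA (a b : R) chi :
  lchar_scale a (lchar_scale b chi) = lchar_scale (a * b) chi.
Proof. by apply: charP => m; rewrite /= scalerA. Qed.
Fact lchar_scale1 : left_id 1 lchar_scale.
Proof. by move=> chi; apply: charP => m; rewrite /= scale1r. Qed.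
Fact lchar_scaleDr : right_distributive lchar_scale +%R.
Proof. by move=> a f g; apply: charP. Qed.
Fact lchar_scaleDl chi : {morph lchar_scale^~ chi : a b / a + b}.
Proof. by move=> a b; apply: charP => m; rewrite /= scalerDl raddfD. Qed.

HB.instance Definition _ := GRing.Zmodule_isLmodule.Build R (lchar A)
  lchar_scaleA lchar_scale1 lchar_scaleDr lchar_scaleDl.

End Left.
End CharacterModule.

Section TensorHom.
Variables (R : pzRingType) (A : lmodType R^c) (M : lmodType R).

Lemma tensor_ind (P : tensor A M -> Prop) :
    P 0 -> (forall t u, P t -> P u -> P (t - u)) ->
    (forall a m, P (tensor_mk a m)) ->
  forall t, P t.
Proof.
move=> P0 PB Pmk t; have [x <-] := tensor_pi_repr t.
have PD u v : P u -> P v -> P (u + v).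
  by move=> Pu Pv; rewrite -[v]opprK -[- v]sub0r; apply/PB/PB.
have add_pi : zmod_morphism (@tensor_pi R A M) by exact: tensor_piB.
pose pi := mk_additive add_pi.
rewrite -[tensor_pi x]/(pi x) -(freeg_sumE x) raddf_sum.
elim/big_ind: _ => // -[a m] _.
set k := coeff _ _.
have -> : << k *g (a, m) >> = free_gen a m *~ k.
  by rewrite freegU_mulz intz.
rewrite raddfMz; elim: k => [|n IHn|n IHn]; first by rewrite mulr0z.
- by rewrite intS mulrzDr mulr1z; apply: PD => //; apply: Pmk.
- rewrite intS opprD mulrzDr mulrNz mulr1z addrC.
  by apply: PB => //; apply: Pmk.
Qed.

Lemma tensor_lift (V : zmodType) (beta : A -> M -> V) :
    (forall a, zmod_morphism (beta a)) ->
    (forall m, zmod_morphism (beta^~ m)) ->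
    (forall (r : R) a m, beta ((r : R^c) *: a) m = beta a (r *: m)) ->
  exists phi : {additive tensor A M -> V},
    forall a m, phi (tensor_mk a m) = beta a m.
Proof.
move=> betaMB betaAB betaZ.
pose beta1 a := mk_additive (betaMB a); pose beta2 m := mk_additive (betaAB m).
pose F (x : free_ab A M) : V :=
  fglift (fun am : A * M => beta am.1 am.2 : zmodule V) x.
have FB : zmod_morphism F.
  exact: (@lift_is_additive int (A * M)%type (zmodule V)).
pose Fa := mk_additive FB.
have Fgen a m : Fa (free_gen a m) = beta a m.
  by rewrite /= /F liftU scale1r.
have Frel x : tensor_rel x -> Fa x = 0.
  elim=> [|{}x y _ rx _ ry|a a' m|a m m'|r a m];
    rewrite ?raddf0 ?raddfB ?raddfD //.
  - by rewrite rx ry subrr.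
  - by rewrite !Fgen; have /= -> := raddfD (beta2 m) a a'; rewrite -opprD subrr.
  - by rewrite !Fgen; have /= -> := raddfD (beta1 a) m m'; rewrite -opprD subrr.
  - by rewrite !Fgen betaZ subrr.
pose phi (t : tensor A M) : V :=
  Fa (repr (t : Quotient.quot (@tensor_pred R A M))).
have phi_pi x : phi (tensor_pi x) = Fa x.
  apply/eqP; rewrite -subr_eq0 -raddfB; apply/eqP/Frel/tensor_piP.
  by rewrite /tensor_pi reprK.
have add_phi : zmod_morphism phi.
  move=> t u; have [x <-] := tensor_pi_repr t; have [y <-] := tensor_pi_repr u.
  by rewrite -tensor_piB !phi_pi raddfB.
by exists (mk_additive add_phi) => a m; rewrite /= phi_pi Fgen.
Qed.

Let tensor_mk_rel (x y : free_ab A M) :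
  tensor_rel (x - y) -> tensor_pi x = tensor_pi y.
Proof. by move/tensor_piP. Qed.

Lemma tensor_piD (x y : free_ab A M) :
  tensor_pi (x + y) = tensor_pi x + tensor_pi y.
Proof. exact: (raddfD \pi_(Quotient.quot (@tensor_pred R A M))%qT). Qed.

Lemma tensor_mkDl a a' m :
  tensor_mk (a + a') m = tensor_mk a m + tensor_mk a' m :> tensor A M.
Proof. by rewrite -tensor_piD; apply/tensor_mk_rel/tensor_relDl. Qed.

Lemma tensor_mkDr a m m' :
  tensor_mk a (m + m') = tensor_mk a m + tensor_mk a m' :> tensor A M.
Proof. by rewrite -tensor_piD; apply/tensor_mk_rel/tensor_relDr. Qed.

Lemma tensor_mkZ (r : R) a m :
  tensor_mk ((r : R^c) *: a) m = tensor_mk a (r *: m) :> tensor A M.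
Proof. by apply/tensor_mk_rel/tensor_relZ. Qed.

Lemma tensor_mkBl a a' m :
  tensor_mk (a - a') m = tensor_mk a m - tensor_mk a' m :> tensor A M.
Proof. by apply: (addIr (tensor_mk a' m)); rewrite -tensor_mkDl !subrK. Qed.

Lemma tensor_mkBr a m m' :
  tensor_mk a (m - m') = tensor_mk a m - tensor_mk a m' :> tensor A M.
Proof. by apply: (addIr (tensor_mk a m')); rewrite -tensor_mkDr !subrK. Qed.

Lemma tensor_of_rchar (h : {linear A -> rchar M}) :
  exists phi : {additive tensor A M -> QZ},
    forall a m, phi (tensor_mk a m) = h a m.
Proof.
apply: tensor_lift => [a|m a a'|r a m]; first exact: raddfB.
  by rewrite linearB.
by rewrite linearZ.
Qed.

Lemma tensor_of_lchar (f : {linear M -> lchar A}) :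
  exists phi : {additive tensor A M -> QZ},
    forall a m, phi (tensor_mk a m) = f m a.
Proof.
apply: tensor_lift => [a m m'|m|r a m]; last by rewrite linearZ.
  by rewrite linearB.
exact: raddfB.
Qed.

Lemma rchar_of_tensor (phi : {additive tensor A M -> QZ}) :
  exists h : {linear A -> rchar M}, forall a m, h a m = phi (tensor_mk a m).
Proof.
have hB a : zmod_morphism (fun m => phi (tensor_mk a m)).
  by move=> m m'; rewrite tensor_mkBr raddfB.
pose h a : rchar M := mk_additive (hB a).
have lin_h : linear h.
  by move=> r a b; apply: charP => m; rewrite /= tensor_mkDl raddfD tensor_mkZ.
by exists (mk_linear lin_h).
Qed.

Lemma lchar_of_tensor (phi : {additive tensor A M -> QZ}) :
  exists h : {linear M -> lchar A}, forall m a, h m a = phi (tensor_mk a m).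
Proof.
have hB m : zmod_morphism (fun a => phi (tensor_mk a m)).
  by move=> a a'; rewrite tensor_mkBl raddfB.
pose h m : lchar A := mk_additive (hB m).
have lin_h : linear h.
  move=> r m m'; apply: charP => a.
  by rewrite /= tensor_mkDr raddfD -tensor_mkZ.
by exists (mk_linear lin_h).
Qed.

Lemma tensor_additive_ext (V : zmodType) (phi psi : tensor A M -> V) :
    zmod_morphism phi -> zmod_morphism psi ->
    (forall a m, phi (tensor_mk a m) = psi (tensor_mk a m)) ->
  forall t, phi t = psi t.
Proof.
move=> addf addg E; elim/tensor_ind=> // [|t u tE uE].
  by rewrite -(subrr 0) addf addg !subrr.
by rewrite addf addg tE uE.
Qed.

End TensorHom.

Definition tensor_map_additive (R : pzRingType) (A B : lmodType R^c)
    (M N : lmodType R) (f : {linear A -> B}) (g : {linear M -> N}) :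
  {additive tensor A M -> tensor B N} :=
  mk_additive (@tensor_mapB R A B M N f g).

Section Lambek.
Variable R : pzRingType.

(** A linear map A -> M^+ is a character of A (x) M; it extends along A -> B
    because A (x) M embeds in B (x) M and Q/Z is injective. *)
Lemma flat_rchar_injective (M : lmodType R) :
  flat M -> injective_module (rchar M).
Proof.
move=> flatM A B i inj_i f; have [phi phiP] := tensor_of_rchar f.
have [t|psi psiP] :=
  @char_extension _ _ (tensor_map_additive i (idfun : {linear M -> M})) phi.
  have h0 := raddf0 (tensor_map_additive i (idfun : {linear M -> M})).
  by move=> /= t0; rewrite (flatM _ _ _ inj_i t 0) ?raddf0 // t0.
have [g gP] := rchar_of_tensor psi; exists g => a; apply: charP => m.
by rewrite gP -phiP -psiP /= tensor_mapE.
Qed.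

(** A nonzero element of A (x) M is detected by a character, which extends
    along A (x) M -> B (x) M because M^+ is injective; so its image in
    B (x) M is nonzero. *)
Lemma rchar_injective_flat (M : lmodType R) :
  injective_module (rchar M) -> flat M.
Proof.
move=> injM A B i inj_i t u tu; apply/eqP; rewrite -subr_eq0.
apply/negPn/negP => /char_separation[phi /eqP]; apply.
have [h hP] := rchar_of_tensor phi; have [g gP] := injM _ _ i inj_i h.
have [psi psiP] := tensor_of_rchar g.
have E : phi =1 psi \o tensor_map_additive i (idfun : {linear M -> M}).
  apply: tensor_additive_ext => [||a m]; [exact: raddfB|exact: raddfB|].
  by rewrite /= tensor_mapE psiP gP hP.
by rewrite E /= tensor_mapB tu subrr raddf0.
Qed.

End Lambek.

(** * Submodules, finite sums and rows *)

Section Submodule.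
Variables (S : pzRingType) (M : lmodType S).

(** Submodules are given by propositions, the boolean predicates required by
    subtypes being recovered by excluded middle. *)
Record submodule := Submodule {
  submod_mem : M -> Prop;
  submod_mem0 : submod_mem 0;
  submod_memP : forall r x y,
    submod_mem x -> submod_mem y -> submod_mem (r *: x + y)
}.

Definition submod_pred (N : submodule) : {pred M} :=
  fun x => `[< submod_mem N x >].

Fact submod_pred_closed N : GRing.submod_closed (submod_pred N).
Proof.
split=> [|r x y /asboolP Nx /asboolP Ny]; apply/asboolP.
  exact: submod_mem0.
exact: submod_memP.
Qed.

HB.instance Definition _ N :=
  GRing.isSubmodClosed.Build S M (submod_pred N) (submod_pred_closed N).

Record submod (N : submodule) := SubmodElt {
  submod_val :> M;
  submod_valP : submod_val \in submod_pred N
}.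

HB.instance Definition _ N := [isSub for @submod_val N].
HB.instance Definition _ N := [Choice of submod N by <:].
HB.instance Definition _ N := [SubChoice_isSubLmodule of submod N by <:].

Definition submod_incl N : {linear submod N -> M} := val.

Lemma submod_incl_inj N : injective (@submod_incl N).
Proof. exact: val_inj. Qed.

Lemma submod_inclP N x :
  submod_mem N x <-> exists y : submod N, submod_incl N y = x.
Proof.
split=> [Nx|[y <-]]; last exact/asboolP/submod_valP.
by exists (SubmodElt (asboolT Nx : x \in submod_pred N)).
Qed.

End Submodule.


Section SubmoduleExamples.
Variables (S : pzRingType) (A B : lmodType S).

Definition ker_submodule (f : {linear A -> B}) : submodule A.
Proof.
exists (fun x => f x = 0) => [|r x y fx fy]; first exact: linear0.
by rewrite linearP fx fy scaler0 addr0.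
Defined.

Definition im_submodule (f : {linear A -> B}) : submodule B.
Proof.
exists (fun y => exists x, f x = y) => [|r _ _ [x <-] [y <-]].
  by exists 0; rewrite linear0.
by exists (r *: x + y); rewrite linearP.
Defined.

Lemma linear_lift_submod (N : submodule B) (f : {linear A -> B}) :
    (forall x, submod_mem N (f x)) ->
  exists g : {linear A -> submod N}, forall x, submod_incl N (g x) = f x.
Proof.
move=> fN.
pose g x : submod N := SubmodElt (asboolT (fN x) : f x \in submod_pred N).
have lin_g : linear g.
  by move=> r x y; apply: val_inj; rewrite linearP /= linearP.
by exists (mk_linear lin_g).
Qed.
End SubmoduleExamples.

Lemma char_sumE (M : zmodType) (T : Type) (s : seq T) (F : T -> char M) x :
  (\sum_(i <- s) F i) x = \sum_(i <- s) F i x.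
Proof. by elim/big_rec2: _ => // i y chi _ <-. Qed.

Lemma tensor_sum (R : pzRingType) (A : lmodType R^c) (M : lmodType R)
    (t : tensor A M) :
  exists s : seq (A * M), t = \sum_(am <- s) tensor_mk am.1 am.2.
Proof.
elim/tensor_ind: t => [|t u [s ->] [s' ->]|a m].
- by exists [::]; rewrite big_nil.
- exists (s ++ [seq (- am.1, am.2) | am <- s']).
  rewrite big_cat big_map /= -sumrN; congr (_ + _); apply: eq_bigr => am _.
  by rewrite -[- am.1]sub0r tensor_mkBl -(subrr 0) tensor_mkBl subrr sub0r.
- by exists [:: (a, m)]; rewrite big_seq1.
Qed.

Lemma row_linear (S : pzRingType) (M : lmodType S) (n : nat)
    (f : {linear 'rV[S]_n -> M}) v :
  f v = \sum_l v 0 l *: f (delta_mx 0 l).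
Proof.
rewrite {1}[v]row_sum_delta linear_sum; apply: eq_bigr => l _.
by rewrite linearZ.
Qed.

Lemma linear_of_row (S : pzRingType) (M : lmodType S) (n : nat)
    (a : 'I_n -> M) :
  exists f : {linear 'rV[S]_n -> M}, forall l, f (delta_mx 0 l) = a l.
Proof.
have lin_f : linear (fun v : 'rV[S]_n => \sum_l v 0 l *: a l).
  move=> r v w; rewrite scaler_sumr -big_split; apply: eq_bigr => l _.
  by rewrite !mxE scalerDl scalerA.
exists (mk_linear lin_f) => l /=.
rewrite (bigD1 l) //= big1 ?addr0 => [|k neq_kl].
  by rewrite mxE !eqxx scale1r.
by rewrite mxE (negPf neq_kl) andbF scale0r.
Qed.

(** * Characters of injective modules over a coherent ring *)

Section Coherent.
Variable R : pzRingType.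

Lemma baer_injective (S : pzRingType) (I : lmodType S) :
  baer_property I -> injective_module I.
Proof.
move=> baerI A B i inj_i f; apply: baer_extension => // a ia0.
by rewrite (inj_i a 0) ?linear0.
Qed.

(** Characters of an injective module I satisfy the equational criterion for
    the relations of a finitely presented right ideal J.  Let Q : I^n -> I^m be
    given by the matrix of q.  A vector a in ker Q is a linear map from J to I,
    which extends to R and thus has the form a_l = c x_l with x_l = i(p(e_l));
    the hypothesis on xi says that the character a |-> sum_l xi_l(a_l) of I^n
    kills such vectors, so it factors through Q, and the factor is eta. *)
Lemma lchar_relation (I J : lmodType R^c) (i : {linear J -> R^c^o})
    (m n : nat) (q : {linear 'rV[R^c]_m -> 'rV[R^c]_n})
    (p : {linear 'rV[R^c]_n -> J})
    (xi : 'I_n -> lchar I) :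
    injective_module I -> injective i -> exact_at q p -> surj p ->
    \sum_l (i (p (delta_mx 0 l)) : R) *: xi l = 0 ->
  exists eta : 'I_m -> lchar I,
    forall l, xi l = \sum_j (q (delta_mx 0 j) 0 l : R) *: eta j.
Proof.
move=> injI inj_i exqp sp xi0.
pose Q (a : 'I_n -> I) (j : 'I_m) : I := \sum_l q (delta_mx 0 j) 0 l *: a l.
pose Xi (a : 'I_n -> I) : QZ := \sum_l xi l (a l).
have QB : zmod_morphism Q.
  move=> a b; apply/funext => j; rewrite -[RHS]/(Q a j - Q b j) /Q -sumrB.
  by apply: eq_bigr => l _; rewrite -scalerBr.
have XiB : zmod_morphism Xi.
  by move=> a b; rewrite /Xi -sumrB; apply: eq_bigr => l _; rewrite -raddfB.
(* H is the character of I^m; its restrictions to the coordinates are eta. *)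
have [a Qa0|H HP] := @char_extension _ _ (mk_additive QB) (mk_additive XiB).
  have [alpha alphaP] := linear_of_row a.
  have [|g gP] := linear_descend sp (f := alpha).
    move=> v /exqp[w <-].
    rewrite -[LHS]/((alpha \o q) w) row_linear big1 // => j _.
    rewrite /= row_linear; under eq_bigr do rewrite alphaP.
    by rewrite [X in _ *: X](congr1 (fun b => b j) Qa0) scaler0.
  have [G GP] := injI _ _ i inj_i g.
  have aP l : a l = i (p (delta_mx 0 l)) *: G 1.
    by rewrite -alphaP -gP -GP -linearZ /= /GRing.scale /= mulr1.
  rewrite /= /Xi; under eq_bigr do rewrite aP.
  have := congr1 (fun chi : lchar I => chi (G 1)) xi0.
  by rewrite /= (@char_sumE I).
pose single (T : finType) (k : T) (x : I) : T -> I :=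
  fun l => if l == k then x else 0.
have etaB j : zmod_morphism (fun x => H (single _ j x)).
  move=> x y; rewrite -raddfB; congr (H _); apply/funext => l.
  rewrite -[RHS]/(single _ j x l - single _ j y l) /single.
  by case: ifP; rewrite ?subrr.
exists (fun j => mk_additive (etaB j)) => l; apply: charP => x.
rewrite (@char_sumE I) /=.
have -> : xi l x = Xi (single _ l x).
  rewrite /Xi (bigD1 l) //= /single eqxx big1 ?addr0 // => k /negPf ->.
  exact: raddf0.
have /= <- := HP (single _ l x).
have -> : Q (single _ l x) = \sum_j single _ j (q (delta_mx 0 j) 0 l *: x).
  rewrite fct_sumE; apply/funext => j; rewrite /Q (bigD1 l) //= /single eqxx.
  rewrite big1 => [|k /negPf ->]; last exact: scaler0.
  rewrite addr0 (bigD1 j) //= eqxx big1 ?addr0 // => k /negPf.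
  by rewrite eq_sym => ->.
by rewrite raddf_sum.
Qed.

Lemma lchar_relation_vanish (I J : lmodType R^c) (i : {linear J -> R^c^o})
    (m n : nat) (q : {linear 'rV[R^c]_m -> 'rV[R^c]_n})
    (p : {linear 'rV[R^c]_n -> J})
    (xi : 'I_n -> lchar I) (g : {linear J -> rchar (lchar I)}) :
    injective_module I -> injective i -> exact_at q p -> surj p ->
    \sum_l (i (p (delta_mx 0 l)) : R) *: xi l = 0 ->
  \sum_l g (p (delta_mx 0 l)) (xi l) = 0.
Proof.
move=> injI inj_i exqp sp xi0.
have [eta etaP] := lchar_relation injI inj_i exqp sp xi0.
under eq_bigr do rewrite etaP raddf_sum.
rewrite exchange_big big1 // => j _.
have qj : g (p (q (delta_mx 0 j))) = 0.
  have -> : p (q (delta_mx 0 j)) = 0 by apply/exqp; exists (delta_mx 0 j).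
  exact: linear0.
rewrite -[RHS](congr1 (fun chi : rchar (lchar I) => chi (eta j)) qj).
rewrite [p _]row_linear linear_sum (@char_sumE (lchar I)).
apply: eq_bigr => l _.
by rewrite linearZ.
Qed.

(** For a right ideal J, this is the injectivity of J (x) I^+ -> I^+ in terms
    of pairings h.  Only the ideal J' generated by the x that occur matters; it
    is finitely presented by coherence, and rewriting the sum on the generators
    of its presentation reduces to [lchar_relation_vanish]. *)
Lemma ideal_tensor_vanish (I : lmodType R^c) (J : submodule R^c^o)
    (h : {linear submod J -> rchar (lchar I)}) (s : seq (submod J * lchar I)) :
    right_coherent R -> injective_module I ->
    \sum_(xn <- s) (submod_val xn.1 : R) *: xn.2 = 0 ->
  \sum_(xn <- s) h xn.1 xn.2 = 0.
Proof.
move=> cohR injI s0.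
pose x k := (nth (0, 0) s k).1; pose xi k := (nth (0, 0) s k).2.
have [u uP] := linear_of_row (fun k : 'I_(size s) => x k).
pose J' := im_submodule (submod_incl J \o u).
have memJ' v : submod_mem J' (submod_incl J (u v)) by exists v.
have [u' u'P] := linear_lift_submod (f := submod_incl J \o u) memJ'.
have su' : surj u'.
  move=> y.
  have [v vP] := (submod_inclP J' (submod_val y)).2 (ex_intro _ y erefl).
  by exists v; apply: (@submod_incl_inj _ _ J'); rewrite u'P.
have [m [n [q [p [exqp sp]]]]] : fin_presented (submod J').
  apply: (cohR _ (submod_incl J') (@submod_incl_inj _ _ J')).
  by exists (size s), u'.
have memJ y : submod_mem J (submod_incl J' y).
  by have [v <-] := su' y; rewrite u'P; apply/submod_inclP; exists (u v).
have [w wP] := linear_lift_submod (f := submod_incl J') memJ.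
have wu' v : w (u' v) = u v by apply: (@submod_incl_inj _ _ J); rewrite wP u'P.
have [y yP] := choice (fun k : 'I_(size s) => sp (u' (delta_mx 0 k))).
have xE (k : 'I_(size s)) : x k = w (p (y k)) by rewrite yP wu' uP.
pose eta l := \sum_k (y k 0 l : R) *: xi k.
have lcomb (g : {linear submod J' -> rchar (lchar I)}) (k : 'I_(size s)) :
    g (p (y k)) (xi k) = \sum_l g (p (delta_mx 0 l)) ((y k 0 l : R) *: xi k).
  rewrite -[g (p _)]/((g \o p) (y k)) row_linear (@char_sumE (lchar I)).
  by apply: eq_bigr => l _.
rewrite (big_nth (0, 0)) big_mkord.
have -> : \sum_(k < size s) h (nth (0, 0) s k).1 (nth (0, 0) s k).2 =
    \sum_l (h \o w) (p (delta_mx 0 l)) (eta l).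
  under [RHS]eq_bigr do rewrite raddf_sum.
  rewrite exchange_big; apply: eq_bigr => k _.
  by rewrite -[LHS]/(h (x k) (xi k)) xE -[h _]/((h \o w) _) lcomb.
apply: (lchar_relation_vanish (h \o w) (i := submod_incl J') injI _ exqp sp).
  exact: submod_incl_inj.
rewrite -[RHS]s0 (big_nth (0, 0)) big_mkord.
under eq_bigr do rewrite scaler_sumr.
rewrite exchange_big; apply: eq_bigr => k _.
rewrite -[RHS]/((submod_incl J (x k) : R) *: xi k) xE wP.
rewrite -[submod_incl J' (p _)]/((submod_incl J' \o p) (y k)) row_linear.
rewrite scaler_suml; apply: eq_bigr => l _.
by rewrite scalerA.
Qed.

(** By Baer's criterion and Lambek's theorem it suffices to extend h : J -> N^+
    to R, where N = I^+.  As a character of J (x) N it factors through the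
    multiplication J (x) N -> N, and an extension to N of the factor is the
    value at 1 of the required map R -> N^+. *)
Lemma coherent_lchar_flat (I : lmodType R^c) :
  right_coherent R -> injective_module I -> flat (lchar I).
Proof.
move=> cohR injI; apply/rchar_injective_flat/baer_injective => J h J0 linJ linh.
pose N := lchar I.
pose JJ := @Submodule _ R^c^o J J0 linJ.
have memJ (x : submod JJ) : J (submod_val x).
  by apply/(submod_inclP JJ); exists x.
have lin_hJ : linear (fun x : submod JJ => h (submod_val x)).
  by move=> a x y; rewrite -linh.
pose hJ := mk_linear lin_hJ.
have [phi phiP] := tensor_of_rchar hJ.
have [||| f fP] :=
  @tensor_lift _ (submod JJ) N N (fun x n => (submod_val x : R) *: n).
- by move=> x n n'; rewrite scalerBr.
- by move=> n x y; rewrite -scalerBl.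
- by move=> r x n; rewrite scalerA.
have [t|psi psiP] := @char_extension _ _ f phi.
  have [s ->] := tensor_sum t; rewrite !raddf_sum => f0.
  under eq_bigr do rewrite phiP.
  apply: ideal_tensor_vanish => //.
  by rewrite -[RHS]f0; apply: eq_bigr => xn _; rewrite fP.
exists psi => r Jr; apply: charP => n.
have [x xr] := (submod_inclP JJ r).1 Jr.
by rewrite rcharZE -xr -[LHS]/(hJ x n) -phiP -psiP fP.
Qed.

End Coherent.

(** * Vanishing of Ext into character modules *)

Section Ext.
Variable R : pzRingType.

Definition rchar_map_fun (M N : lmodType R) (g : {linear M -> N})
    (chi : rchar N) : rchar M :=
  Algebra.Additive.clone M QZ (char_fun chi \o g) _.

Fact rchar_map_linear (M N : lmodType R) (g : {linear M -> N}) :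
  linear (rchar_map_fun g).
Proof. by move=> r chi chi'; apply: charP => m /=; rewrite -linearZ. Qed.

Definition rchar_map (M N : lmodType R) (g : {linear M -> N}) :
  {linear rchar N -> rchar M} :=
  mk_linear (rchar_map_linear g).

(** Ext^1(F, A^+) = 0 for F flat and A arbitrary.  The transpose
    beta^* : F^+ -> X^+ has a retraction rho because F^+ is injective.  For each
    a, the character z |-> f z a of P extends along alpha, uniquely so if the
    extension is required to lie in the kernel of rho; that normalization makes
    it linear in a. *)
Lemma flat_lchar_extension (A : lmodType R^c) (P X F : lmodType R)
    (alpha : {linear P -> X}) (beta : {linear X -> F})
    (f : {linear P -> lchar A}) :
    flat F -> surj beta -> exact_at alpha beta ->
    (forall z, alpha z = 0 -> f z = 0) ->
  exists h : {linear X -> lchar A}, forall z, h (alpha z) = f z.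
Proof.
move=> flatF sbeta exab kf.
have inj_bs : injective (rchar_map beta).
  move=> chi chi' E; apply: charP => y; have [x <-] := sbeta y.
  exact: (congr1 (fun c : rchar X => c x) E).
have [rho rhoP] :=
  flat_rchar_injective flatF inj_bs (idfun : {linear rchar F -> rchar F}).
have [||chi [chi0 rho0]|H HP] := @linear_of_rel _ A (rchar X)
    (fun a chi => (forall z, chi (alpha z) = f z a) /\ rho chi = 0).
- move=> r a a' chi chi' [Ea ra] [Ea' ra']; split=> [z|].
    by rewrite charDE rcharZE -linearZ Ea Ea' linearZ raddfD.
  by rewrite linearP ra ra' scaler0 addr0.
- move=> a; have faB : zmod_morphism (fun z => f z a).
    by move=> z z'; rewrite linearB.
  have [z az|chi chiP] := @char_extension _ _ alpha (mk_additive faB).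
    by rewrite /= kf.
  pose chi' : rchar X := chi.
  exists (chi' - rchar_map beta (rho chi')); split=> [z|]; last first.
    by rewrite linearB rhoP subrr.
  have baz : beta (alpha z) = 0 by apply/exab; exists z.
  by rewrite charDE charNE /= baz raddf0 subr0; apply: chiP.
- have [x|om omP] := @char_extension _ _ beta chi.
    by move=> /exab[z <-]; rewrite chi0 raddf0.
  have E : chi = rchar_map beta om by apply: charP => x; rewrite /= omP.
  by rewrite E -[X in rchar_map beta X]rhoP -E rho0 linear0.
have [phi phiP] := tensor_of_rchar H; have [h hP] := lchar_of_tensor phi.
by exists h => z; apply: charP => a; rewrite hP phiP (HP a).1.
Qed.

(** Exactness of I (x) F2 -> I (x) F1 -> I (x) F0 makes the character of
    I (x) F1 given by f factor through the image in I (x) F0. *)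
Lemma tensor_exact_lchar_extension (I : lmodType R^c) (F2 F1 F0 : lmodType R)
    (d2 : {linear F2 -> F1}) (d1 : {linear F1 -> F0})
    (f : {linear F1 -> lchar I}) :
    exact_at (tensor_map (idfun : {linear I -> I}) d2)
             (tensor_map (idfun : {linear I -> I}) d1) ->
    (forall u, f (d2 u) = 0) ->
  exists g : {linear F0 -> lchar I}, forall v, g (d1 v) = f v.
Proof.
move=> exd fd2; have [phi phiP] := tensor_of_lchar f.
have [t|psi psiP] :=
  @char_extension _ _ (tensor_map_additive (idfun : {linear I -> I}) d1) phi.
  move=> /exd[s <-].
  rewrite -[LHS]/((phi \o tensor_map_additive (idfun : {linear I -> I}) d2) s).
  apply: (tensor_additive_ext (psi := \0)) => [||a u]; first exact: raddfB.
    by move=> x y /=; rewrite subr0.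
  by rewrite /= tensor_mapE phiP fd2.
have [g gP] := lchar_of_tensor psi; exists g => v; apply: charP => a.
by rewrite gP -phiP -psiP /= tensor_mapE.
Qed.

(** Two presentations of G are compared on the pullback X of P0 -> G <- F0.
    Since F0 is flat, the cocycle f extends to h on X; since I (x) F is exact,
    the restriction of h to ker (X -> P0), which is the image of F1, comes from
    some g' on F0.  The difference h - g' then descends to P0. *)
Lemma Ext_lchar_eq0 (G F2 F1 F0 : lmodType R) (d2 : {linear F2 -> F1})
    (d1 : {linear F1 -> F0}) (eps : {linear F0 -> G}) (I : lmodType R^c) :
    flat F0 -> surj eps -> exact_at d1 eps -> (forall u, d1 (d2 u) = 0) ->
    exact_at (tensor_map (idfun : {linear I -> I}) d2)
             (tensor_map (idfun : {linear I -> I}) d1) ->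
  Ext1_eq0 G (lchar I).
Proof.
move=> flatF0 seps exeps d1d2 exI P f fd1.
pose P0 := pr_obj P 0.
have ex0 := @pr_exact0 _ _ P; have ex1 := @pr_exact _ _ P 0.
have lin_delta : linear (fun yw : (P0 * F0)%type => pr_aug P yw.1 - eps yw.2).
  by move=> r x y /=; rewrite !linearP addrACA -scalerDr.
pose N := ker_submodule (mk_linear lin_delta); pose X := submod N.
have XP (x : X) : pr_aug P (submod_incl N x).1 = eps (submod_incl N x).2.
  by apply/eqP; rewrite -subr_eq0; apply/eqP/(submod_inclP N); exists x.
have XE y w : pr_aug P y = eps w -> exists x : X, submod_incl N x = (y, w).
  by move=> E; apply/(submod_inclP N); rewrite /= E subrr.
pose pr1 : {linear X -> P0} := fst \o submod_incl N.
pose pr2 : {linear X -> F0} := snd \o submod_incl N.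
have pr1E x : pr1 x = (submod_incl N x).1 by [].
have pr2E x : pr2 x = (submod_incl N x).2 by [].
have lin_i1 : linear (fun z => (pr_diff P 0 z, 0) : (P0 * F0)%type).
  move=> r z z'; rewrite linearP; congr (_, _).
  by rewrite -[RHS]/(r *: (0 : F0) + 0) scaler0 addr0.
have lin_i2 : linear (fun v => (0, d1 v) : (P0 * F0)%type).
  move=> r z z'; rewrite linearP; congr (_, _).
  by rewrite -[RHS]/(r *: (0 : P0) + 0) scaler0 addr0.
have [z /=|alpha alphaP] := linear_lift_submod (N := N) (f := mk_linear lin_i1).
  suff -> : pr_aug P (pr_diff P 0 z) = 0 by rewrite linear0 subrr.
  by apply/ex0; exists z.
have [v /=|gamma gammaP] := linear_lift_submod (N := N) (f := mk_linear lin_i2).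
  suff -> : eps (d1 v) = 0 by rewrite linear0 subrr.
  by apply/exeps; exists v.
have spr2 : surj pr2.
  move=> w; have [y yP] := pr_aug_surj P (eps w).
  by have [x xE] := XE y w yP; exists x; rewrite pr2E xE.
have spr1 : surj pr1.
  move=> y; have [w wP] := seps (pr_aug P y).
  by have [x xE] := XE y w (esym wP); exists x; rewrite pr1E xE.
have exapr2 : exact_at alpha pr2.
  move=> x; split=> [x20|[z <-]]; last by rewrite pr2E alphaP.
  have [z zP] : exists z, pr_diff P 0 z = pr1 x.
    by apply/ex0; rewrite pr1E XP -pr2E x20 linear0.
  exists z; apply: submod_incl_inj.
  by rewrite alphaP /= zP -[0]x20 pr1E pr2E -surjective_pairing.
have [z az|h hP] := flat_lchar_extension (f := f) flatF0 spr2 exapr2.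
  have /ex1[u <-] : pr_diff P 0 z = 0; last exact: fd1.
  have := etrans (esym (congr1 (submod_incl N) az)) (alphaP z).
  by move=> e; exact: esym (congr1 fst e).
have [u|g' g'P] := @tensor_exact_lchar_extension I _ _ _ d2 d1 (h \o gamma) exI.
  rewrite /=; suff -> : gamma (d2 u) = 0 by rewrite linear0.
  by apply: submod_incl_inj; rewrite gammaP linear0 /= d1d2.
have lin_h' : linear (fun x => h x - g' (pr2 x)).
  by move=> r x y; rewrite !linearP addrACA -scalerDr.
have [x x10|g gP] := linear_descend spr1 (f := mk_linear lin_h').
  have [v vP] : exists v, d1 v = pr2 x.
    by apply/exeps; rewrite pr2E -XP -pr1E x10 linear0.
  have -> : x = gamma v.
    apply: submod_incl_inj.
    by rewrite gammaP /= vP -[0]x10 pr1E pr2E -surjective_pairing.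
  by rewrite [LHS]/(h _ - g' _) pr2E gammaP g'P; apply: subrr.
exists g => z.
have := gP (alpha z); rewrite pr1E alphaP => ->.
have g'0 : g' (mk_linear lin_i1 z).2 = 0 by apply: linear0.
rewrite [LHS]/(h _ - g' _) pr2E alphaP g'0 hP; exact: subr0.
Qed.

Lemma gorenstein_flat_Ext_lchar (G : lmodType R) (I : lmodType R^c) :
  gorenstein_flat G -> injective_module I -> Ext1_eq0 G (lchar I).
Proof.
move=> [F [j [inj_j exj]]] injI.
have d0d1 := @cfr_exact R F; have jd0 x : exists g, j g = cfr_diff F (-2 + 1) x.
  by apply/exj/d0d1; exists x.
have [eps epsP] := linear_corestrict inj_j jd0.
apply: (Ext_lchar_eq0 (d2 := cfr_diff F (-2 + 1 + 1 + 1))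
                      (d1 := cfr_diff F (-2 + 1 + 1)) (eps := eps)).
- exact: cfr_flat.
- move=> g; have /d0d1[x xP] : cfr_diff F (-2) (j g) = 0 by apply/exj; exists g.
  by exists x; apply: inj_j; rewrite epsP.
- move=> x; split=> [ex0|/d0d1 dx0].
    by apply/d0d1; rewrite -epsP ex0 linear0.
  by apply: inj_j; rewrite epsP dx0 linear0.
- by move=> u; apply/d0d1; exists u.
- exact: cfr_tensor_exact.
Qed.

End Ext.

(** * Free modules *)

Section FreeModule.
Variables (S : pzRingType) (X : eqType).

Definition lin_comb (A : lmodType S) (g : X -> A) (s : seq (S * X)) : A :=
  \sum_(rx <- s) rx.1 *: g rx.2.

Lemma lin_combP (A : lmodType S) (g : X -> A) r s s' :
  lin_comb g ([seq (r * rx.1, rx.2) | rx <- s] ++ s') =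
  r *: lin_comb g s + lin_comb g s'.
Proof.
rewrite /lin_comb big_cat big_map scaler_sumr; congr (_ + _).
by apply: eq_bigr => rx _; rewrite scalerA.
Qed.

Definition dirac (x : X) : X -> S^o := fun y => if y == x then 1 else 0.

(** Realizing the free module inside the functions X -> S makes equality of two
    combinations pointwise, for an arbitrary X and a possibly trivial S. *)
Definition free_submodule : submodule (X -> S^o).
Proof.
exists (fun f => exists s, f = lin_comb dirac s) => [|r _ _ [s ->] [s' ->]].
  by exists [::]; rewrite /lin_comb big_nil.
by rewrite -lin_combP; eexists.
Defined.

Definition free_module : lmodType S := submod free_submodule.

Fact free_gen_mem x : submod_mem free_submodule (dirac x).
Proof. by exists [:: (1, x)]; rewrite /lin_comb big_seq1 scale1r. Qed.

Definition free_basis (x : X) : free_module :=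
  SubmodElt (asboolT (free_gen_mem x) : dirac x \in submod_pred free_submodule).

Lemma free_module_comb (f : free_module) :
  exists s, submod_incl free_submodule f = lin_comb dirac s.
Proof. by apply/(submod_inclP free_submodule); exists f. Qed.

Lemma free_spanned (f : free_module) : exists s, f = lin_comb free_basis s.
Proof.
have [s sP] := free_module_comb f; exists s.
apply: (@submod_incl_inj _ _ free_submodule).
rewrite sP /lin_comb linear_sum; apply: eq_bigr => rx _.
by rewrite linearZ.
Qed.

(** Collecting equal basis elements: this is what makes the value of a linear
    map on a combination depend only on the combination as a function. *)
Lemma lin_comb_eval (A : lmodType S) (g : X -> A) s :
  lin_comb g s =
  \sum_(y <- undup [seq rx.2 | rx <- s]) (lin_comb dirac s y : S) *: g y.
Proof.
rewrite /lin_comb; under [RHS]eq_bigr do rewrite fct_sumE scaler_suml.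
rewrite exchange_big !big_seq; apply: eq_bigr => rx rxs /=.
have xU : rx.2 \in undup [seq rx.2 | rx <- s] by rewrite mem_undup map_f.
rewrite (bigD1_seq _ xU) ?undup_uniq //= big1 => [|y /negPf neq_y].
  by rewrite addr0 -[(_ *: dirac _) _]/(rx.1 * dirac _ _) /dirac eqxx mulr1.
by rewrite -[(_ *: dirac _) _]/(rx.1 * dirac _ _) /dirac neq_y mulr0 scale0r.
Qed.

Lemma lin_comb_dirac_eq0 (A : lmodType S) (g : X -> A) s :
  lin_comb dirac s = 0 -> lin_comb g s = 0.
Proof.
by move=> s0; rewrite lin_comb_eval big1 // => y _; rewrite s0; apply: scale0r.
Qed.

Lemma free_lift (A : lmodType S) (g : X -> A) :
  exists f : {linear free_module -> A}, forall x, f (free_basis x) = g x.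
Proof.
pose G (f : free_module) a :=
  exists s, submod_incl _ f = lin_comb dirac s /\ a = lin_comb g s.
have [||y [s [s0 ->]]|f fP] := @linear_of_rel _ free_module A G.
- move=> r f f' _ _ [s [fs ->]] [s' [fs' ->]].
  by eexists; rewrite linearP fs fs' -!lin_combP.
- move=> f; have [s sP] := free_module_comb f.
  by exists (lin_comb g s), s.
- by apply: lin_comb_dirac_eq0; rewrite -s0 linear0.
exists f => x; have [s [xs ->]] := fP (free_basis x).
have comb1 (B : lmodType S) (h : X -> B) : lin_comb h [:: (1, x)] = h x.
  by rewrite /lin_comb big_seq1 scale1r.
apply/eqP.
rewrite -subr_eq0 addrC -[- _]scaleN1r -[in - 1 *: _]comb1 -lin_combP.
apply/eqP/lin_comb_dirac_eq0; rewrite lin_combP -xs comb1 scaleN1r.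
exact: addNr.
Qed.

Lemma free_ext (A : lmodType S) (f g : {linear free_module -> A}) :
  (forall x, f (free_basis x) = g (free_basis x)) -> forall v, f v = g v.
Proof.
move=> fg v; have [s ->] := free_spanned v; rewrite /lin_comb !linear_sum.
by apply: eq_bigr => rx _; rewrite !linearZ fg.
Qed.

Lemma free_projective : projective_module free_module.
Proof.
move=> A B p sp f; have [a aP] := choice (fun x => sp (f (free_basis x))).
have [g gP] := free_lift a; exists g.
by apply: (free_ext (f := p \o g)) => x; rewrite /= gP aP.
Qed.

End FreeModule.

(** * Free resolutions and splitting *)

Section Resolution.
Variable S : pzRingType.

Lemma free_cover_exists (M : lmodType S) :
  exists p : {linear free_module S M -> M}, surj p.
Proof.
have [p pP] := free_lift (fun m : M => m).
by exists p => m; exists (free_basis S m).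
Qed.

Definition free_cover (M : lmodType S) : {linear free_module S M -> M} :=
  projT1 (cid (free_cover_exists M)).

Lemma free_cover_surj M : surj (free_cover M).
Proof. exact: (projT2 (cid (free_cover_exists M))). Qed.

(** Since [Ext1_eq0] quantifies over projective resolutions, using it requires
    one; the n-th term is the free module on the n-th iterated kernel. *)
Fixpoint syzygy (M : lmodType S) (n : nat) : lmodType S :=
  if n is n'.+1 then submod (ker_submodule (free_cover (syzygy M n'))) else M.

Definition free_resolution_diff (M : lmodType S) (n : nat) :
    {linear free_module S (syzygy M n.+1) -> free_module S (syzygy M n)} :=
  submod_incl (ker_submodule (free_cover (syzygy M n)))
    \o free_cover (syzygy M n.+1).

Lemma free_resolution_exact M n :
  exact_at (free_resolution_diff M n) (free_cover (syzygy M n)).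
Proof.
move=> x; split=> [x0|[y <-]]; last first.
  apply/(submod_inclP (ker_submodule (free_cover (syzygy M n)))).
  by exists (free_cover (syzygy M n.+1) y).
have [z zx] := (submod_inclP (ker_submodule (free_cover (syzygy M n))) x).1 x0.
have [y yz] := @free_cover_surj (syzygy M n.+1) z.
by exists y; rewrite -zx -yz.
Qed.

Definition free_resolution (M : lmodType S) : proj_resolution M.
Proof.
apply: (@ProjResolution S M (fun n => free_module S (syzygy M n))
  (free_resolution_diff M) (free_cover M)).
- by move=> n; apply: free_projective.
- exact: free_cover_surj.
- exact: free_resolution_exact.
- move=> n x; rewrite -(@free_resolution_exact M n.+1 x); split=> [x0|x0].
    apply: (@submod_incl_inj _ _ (ker_submodule (free_cover (syzygy M n)))).
    by rewrite linear0.
  exact: etrans (congr1 (submod_incl _) x0) (linear0 _).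
Defined.

(** Lifting the augmentation of a resolution P of G to u : P0 -> E yields a
    cocycle P1 -> N, hence g : P0 -> N.  The retraction is induced on E, a
    quotient of P0 + N, by (y, n) |-> n + g y. *)
Lemma Ext1_eq0_split (G N E : lmodType S) (i : {linear N -> E})
    (p : {linear E -> G}) :
    Ext1_eq0 G N -> injective i -> exact_at i p -> surj p ->
  exists r : {linear E -> N}, forall n, r (i n) = n.
Proof.
move=> extGN inj_i exip sp; set P := free_resolution G.
have ex0 := @pr_exact0 _ _ P; have ex1 := @pr_exact _ _ P 0.
have [u uP] := @pr_proj _ _ P 0 _ _ _ sp (pr_aug P).
have [f fP] : exists f : {linear pr_obj P 1 -> N},
    forall z, i (f z) = u (pr_diff P 0 z).
  apply: (linear_corestrict (f := u \o pr_diff P 0)) inj_i _ => z.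
  by apply/exip; rewrite /= uP; apply/ex0; exists z.
have [x|g gP] := extGN P f.
  apply: inj_i; rewrite fP linear0.
  have -> : pr_diff P 0 (pr_diff P 1 x) = 0 by apply/ex1; exists x.
  exact: linear0.
have lin_q : linear (fun yn : (pr_obj P 0 * N)%type => u yn.1 + i yn.2).
  by move=> r x y; rewrite !linearP addrACA -scalerDr.
have lin_s : linear (fun yn : (pr_obj P 0 * N)%type => g yn.1 + yn.2).
  by move=> r x y; rewrite !linearP addrACA -scalerDr.
have [||r rP] := @linear_descend _ _ _ _ (mk_linear lin_q) (mk_linear lin_s).
- move=> e; have [y yP] := @pr_aug_surj _ _ P (p e).
  have [n nP] : exists n, i n = e - u y.
    by apply/exip; rewrite linearB uP yP subrr.
  by exists (y, n); rewrite /= nP addrC subrK.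
- move=> [y n] /= E0; have [z zP] : exists z, pr_diff P 0 z = y.
    apply/ex0; rewrite -uP; have := congr1 p E0; rewrite linearD linear0.
    by have -> : p (i n) = 0 by [apply/exip; exists n]; rewrite addr0.
  by apply: inj_i; rewrite linearD linear0 -[RHS]E0 -zP gP fP.
exists r => n; have := rP (0, n).
by rewrite /= !linear0 !add0r.
Qed.

End Resolution.

(** * Quotient modules *)

Section Quotient.
Variables (S : pzRingType) (M : lmodType S) (N : submodule M).

Definition quotmod : Type := Quotient.quot (submod_pred N).
HB.instance Definition _ := GRing.Zmodule.on quotmod.

Definition quot_class (x : M) : quotmod :=
  (\pi_(Quotient.quot (submod_pred N)) x)%qT.

Lemma quot_class_surj : surj quot_class.
Proof. by move=> y; exists (repr y); apply: reprK. Qed.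

Lemma quot_classP x y : quot_class x = quot_class y <-> submod_mem N (x - y).
Proof.
have E := Quotient.idealrBE (submod_pred N) x y.
split=> [exy|/asboolP rxy]; last by apply/eqP; rewrite -E.
by apply/asboolP; have := E; rewrite (introT eqP exy).
Qed.

Lemma quot_classD x y : quot_class (x + y) = quot_class x + quot_class y.
Proof. exact: (raddfD \pi_(Quotient.quot (submod_pred N))%qT). Qed.

Lemma submod_memZ r x : submod_mem N x -> submod_mem N (r *: x).
Proof.
by move=> Nx; have := submod_memP r Nx (submod_mem0 N); rewrite addr0.
Qed.

Definition quot_scale (r : S) (q : quotmod) : quotmod :=
  quot_class (r *: repr (q : Quotient.quot (submod_pred N))).

Lemma quot_scale_class r x : quot_scale r (quot_class x) = quot_class (r *: x).
Proof.
apply/quot_classP; rewrite -scalerBr; apply/submod_memZ/quot_classP.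
by rewrite /quot_class reprK.
Qed.

Fact quot_scaleA a b q : quot_scale a (quot_scale b q) = quot_scale (a * b) q.
Proof.
by have [x <-] := quot_class_surj q; rewrite !quot_scale_class scalerA.
Qed.
Fact quot_scale1 : left_id 1 quot_scale.
Proof.
move=> q; have [x <-] := quot_class_surj q.
by rewrite quot_scale_class scale1r.
Qed.
Fact quot_scaleDr : right_distributive quot_scale +%R.
Proof.
move=> a q q'.
have [x <-] := quot_class_surj q; have [y <-] := quot_class_surj q'.
by rewrite -quot_classD !quot_scale_class scalerDr quot_classD.
Qed.
Fact quot_scaleDl q : {morph quot_scale^~ q : a b / a + b}.
Proof.
move=> a b; have [x <-] := quot_class_surj q.
by rewrite !quot_scale_class scalerDl quot_classD.
Qed.

HB.instance Definition _ := GRing.Zmodule_isLmodule.Build S quotmod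
  quot_scaleA quot_scale1 quot_scaleDr quot_scaleDl.

Fact quot_class_linear : linear quot_class.
Proof. by move=> r x y; rewrite quot_classD -quot_scale_class. Qed.

Definition quot_proj : {linear M -> quotmod} := mk_linear quot_class_linear.

Lemma quot_proj_eq0 x : quot_proj x = 0 <-> submod_mem N x.
Proof. by rewrite -(linear0 quot_proj) quot_classP subr0. Qed.

End Quotient.

(** * The embedding of a module into its bidual *)

Section Bidual.
Variable R : pzRingType.

Section Left.
Variable M : lmodType R.

Fact bidual_eval_is_zmod_morphism (m : M) :
  zmod_morphism (fun chi : rchar M => chi m).
Proof. by []. Qed.

Definition bidual_eval_fun (m : M) : lchar (rchar M) :=
  mk_additive (bidual_eval_is_zmod_morphism m).

Fact bidual_eval_linear : linear bidual_eval_fun.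
Proof. by move=> r m m'; apply: charP => chi; rewrite /= raddfD. Qed.

Definition bidual_eval : {linear M -> lchar (rchar M)} :=
  mk_linear bidual_eval_linear.

Lemma bidual_evalE m (chi : rchar M) : bidual_eval m chi = chi m.
Proof. by []. Qed.

End Left.

Section Right.
Variable A : lmodType R^c.

Fact rbidual_eval_is_zmod_morphism (a : A) :
  zmod_morphism (fun xi : lchar A => xi a).
Proof. by []. Qed.

Definition rbidual_eval_fun (a : A) : rchar (lchar A) :=
  mk_additive (rbidual_eval_is_zmod_morphism a).

Fact rbidual_eval_linear : linear rbidual_eval_fun.
Proof. by move=> r a b; apply: charP => xi; rewrite /= raddfD. Qed.

Definition rbidual_eval : {linear A -> rchar (lchar A)} :=
  mk_linear rbidual_eval_linear.

End Right.

Lemma bidual_eval_inj (M : lmodType R) : injective (bidual_eval M).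
Proof.
move=> m m' E; apply/eqP; rewrite -subr_eq0.
apply/negPn/negP => /char_separation[chi].
have := bidual_evalE m (chi : rchar M).
by rewrite E bidual_evalE raddfB => ->; rewrite subrr eqxx.
Qed.

(** Q^+ is a retract of the injective module E^+, E = M^(++): for theta in
    E^+, subtracting from theta the evaluation at its restriction to M gives a
    character that vanishes on M, so an element of Q^+, and nothing is
    subtracted if theta comes from Q. *)
Lemma bidual_cokernel_flat (M Q : lmodType R)
    (p : {linear lchar (rchar M) -> Q}) :
  flat (lchar (rchar M)) -> exact_at (bidual_eval M) p -> surj p -> flat Q.
Proof.
set E := lchar (rchar M) => flatE exp sp.
apply: rchar_injective_flat => A B i inj_i f.
pose ev := bidual_eval M.
have [g gP] := flat_rchar_injective flatE inj_i (rchar_map p \o f).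
pose sigma (theta : rchar E) := theta - rbidual_eval _ (rchar_map ev theta).
have lin_sigma : linear sigma.
  by move=> r x y; rewrite /sigma !linearP addrACA -scalerDr.
have inj_ps : injective (rchar_map p).
  move=> chi chi' H; apply: charP => y; have [x <-] := sp y.
  exact: (congr1 (fun c : rchar E => c x) H).
have [theta|tau tauP] := linear_corestrict (f := mk_linear lin_sigma) inj_ps.
  have [x|psi psiP] := @char_extension _ _ p (sigma theta).
    by move=> /exp[m <-]; apply: subrr.
  by exists psi; apply: charP => x; apply: psiP.
exists (tau \o g) => a; apply: inj_ps; rewrite [LHS]tauP.
rewrite [LHS]/(g (i a) - rbidual_eval _ (rchar_map ev (g (i a)))) gP.
have -> : rchar_map ev ((rchar_map p \o f) a) = 0.
  apply: charP => m /=; have -> : p (ev m) = 0 by apply/exp; exists m.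
  exact: raddf0.
by rewrite linear0; apply: subr0.
Qed.

Lemma flat_cotorsion_bidual_split (M : lmodType R) :
    right_coherent R -> flat M -> cotorsion M ->
  exists r : {linear lchar (rchar M) -> M}, forall m, r (bidual_eval M m) = m.
Proof.
move=> cohR flatM cotM; set E := lchar (rchar M).
have flatE : flat E by apply/coherent_lchar_flat/flat_rchar_injective.
pose N := im_submodule (bidual_eval M); pose p := quot_proj N.
have exp : exact_at (bidual_eval M) p by move=> x; apply: quot_proj_eq0.
have sp : surj p by apply: quot_class_surj.
apply: (Ext1_eq0_split _ (@bidual_eval_inj M) exp sp).
exact/cotM/(bidual_cokernel_flat flatE exp sp).
Qed.

Lemma Ext1_eq0_retract (G N E : lmodType R) (i : {linear N -> E})
    (r : {linear E -> N}) :
  (forall n, r (i n) = n) -> Ext1_eq0 G E -> Ext1_eq0 G N.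
Proof.
move=> ri extGE P f fd; have [x|g gP] := extGE P (i \o f).
  by rewrite /= fd linear0.
by exists (r \o g) => x; rewrite /= gP /= ri.
Qed.

Lemma flat_cotorsion_gorenstein_cotorsion (M : lmodType R) :
  right_coherent R -> flat M -> cotorsion M -> gorenstein_cotorsion M.
Proof.
move=> cohR flatM cotM G gfG.
have [r rP] := flat_cotorsion_bidual_split cohR flatM cotM.
apply: (Ext1_eq0_retract rP).
exact/gorenstein_flat_Ext_lchar/flat_rchar_injective.
Qed.

End Bidual.

(** * The two classes and their cores *)

Section Core.
Variable R : pzRingType.

Lemma odd_abszD1 (n : int) : odd (absz (n + 1)) = ~~ odd (absz n).
Proof.
case: n => n; first by rewrite -PoszD addn1.
have -> : Negz n + 1 = - n%:Z by rewrite NegzE -addn1 PoszD opprD subrK.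
by rewrite abszN /= negbK.
Qed.

(** The complex  M -id-> M -0-> M -id-> M, which has M as a cycle module.
    Unlike the complex M = M in two degrees, all its terms are the same type. *)
Definition alternating_diff (M : lmodType R) (n : int) : {linear M -> M} :=
  if odd (absz n) then (idfun : {linear M -> M}) else (\0 : {linear M -> M}).

Lemma tensor_map_id (A : lmodType R^c) (M : lmodType R) (t : tensor A M) :
  tensor_map (idfun : {linear A -> A}) (idfun : {linear M -> M}) t = t.
Proof.
apply: (tensor_additive_ext (phi := tensor_map _ _) (psi := id)) t =>
  // [t u|a m].
  exact: tensor_mapB.
by rewrite tensor_mapE.
Qed.

Lemma tensor_map_null (A : lmodType R^c) (M N : lmodType R) (t : tensor A M) :
  tensor_map (idfun : {linear A -> A}) (\0 : {linear M -> N}) t = 0.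
Proof.
apply: (tensor_additive_ext (phi := tensor_map _ _) (psi := \0)) t =>
  [t u|t u|a m].
- exact: tensor_mapB.
- by rewrite /= subr0.
- rewrite tensor_mapE /=; have := tensor_mkBr a (0 : N) 0.
  by rewrite !subrr.
Qed.

Lemma alternating_exact (M : lmodType R) n :
  exact_at (alternating_diff M (n + 1)) (alternating_diff M n).
Proof.
rewrite /alternating_diff odd_abszD1 => y; case: odd => /=; split.
- by move=> y0; exists 0.
- by case=> x <-.
- by exists y.
- by [].
Qed.

Lemma alternating_tensor_exact (I : lmodType R^c) (M : lmodType R) n :
  exact_at (tensor_map (idfun : {linear I -> I}) (alternating_diff M (n + 1)))
           (tensor_map (idfun : {linear I -> I}) (alternating_diff M n)).
Proof.
rewrite /alternating_diff odd_abszD1 => y; case: odd => /=; split.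
- by rewrite tensor_map_id => ->; exists 0; rewrite tensor_map_null.
- by case=> x <-; rewrite tensor_map_id tensor_map_null.
- by exists y; rewrite tensor_map_id.
- by rewrite tensor_map_null.
Qed.

Lemma flat_gorenstein_flat (M : lmodType R) : flat M -> gorenstein_flat M.
Proof.
move=> flatM.
exists (@CompleteFlatResolution R (fun=> M) (alternating_diff M) (fun=> flatM)
  (@alternating_exact M) (fun I _ => @alternating_tensor_exact I M)).
exists (idfun : {linear M -> M}); split=> // y.
by split=> // _; exists y.
Qed.

Section Shift.
Variable F : complete_flat_resolution R.

(** Shifting a complex indexed by the integers meets n + 1 - 1 and n - 1 + 1,
    which are not convertible.  Transporting the differentials along arbitrary
    equations between indices keeps exactness a matter of substitution. *)
Definition cfr_map (m n : int) (e : m = n + 1) :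
  {linear cfr_obj F m -> cfr_obj F n} :=
  ecast k {linear cfr_obj F k -> cfr_obj F n} (esym e) (cfr_diff F n).

Lemma cfr_map_exact (k m n : int) (e : k = m + 1) (e' : m = n + 1) :
  exact_at (cfr_map e) (cfr_map e').
Proof. by subst m; subst k; apply: cfr_exact. Qed.

Lemma cfr_map_tensor_exact (I : lmodType R^c) (k m n : int)
    (e : k = m + 1) (e' : m = n + 1) :
    injective_module I ->
  exact_at (tensor_map (idfun : {linear I -> I}) (cfr_map e))
           (tensor_map (idfun : {linear I -> I}) (cfr_map e')).
Proof. by move=> injI; subst m; subst k; apply: cfr_tensor_exact. Qed.

Fact shift_index (n : int) : n + 1 - 1 = n - 1 + 1.
Proof. by rewrite addrAC. Qed.

Definition shift_resolution : complete_flat_resolution R :=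
  @CompleteFlatResolution R (fun n => cfr_obj F (n - 1))
    (fun n => cfr_map (shift_index n)) (fun n => @cfr_flat R F (n - 1))
    (fun n => cfr_map_exact _ _)
    (fun I injI n => cfr_map_tensor_exact _ _ injI).

End Shift.

(** The cokernel of M -> F_(-1) is the next cycle module ker (F_(-2) ->
    F_(-3)), which is Gorenstein flat by the shifted complex. *)
Lemma gorenstein_flat_cosyzygy (M : lmodType R) : gorenstein_flat M ->
  exists (F N : lmodType R) (i : {linear M -> F}) (p : {linear F -> N}),
    [/\ flat F, gorenstein_flat N, injective i, exact_at i p & surj p].
Proof.
move=> [F [j [inj_j exj]]].
pose d := cfr_diff (shift_resolution F) (-2).
pose N := ker_submodule d.
have e : -2 + 1 = (-2 + 1 - 1) + 1 :> int by [].
have exd := cfr_map_exact e (shift_index (-2)).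
have [x|p pP] := linear_lift_submod (N := N) (f := cfr_map F e).
  by apply/exd; exists x.
exists (cfr_obj F (-2 + 1)), (submod N), j, p; split=> //.
- exact: cfr_flat.
- exists (shift_resolution F), (submod_incl N).
  split; first exact: submod_incl_inj.
  exact: (submod_inclP N).
- have exj' : exact_at j (cfr_map F e).
    have en : -2 = -2 + 1 - 1 :> int by [].
    move: e {exd p pP}; case: _ / en => e.
    by rewrite /cfr_map (eq_irrelevance e erefl).
  move=> x; rewrite -exj'; split=> [px0|x0]; first by rewrite -pP px0 linear0.
  by apply: (@submod_incl_inj _ _ N); rewrite pP x0 linear0.
- move=> y.
  have /exd[x xP] : cfr_map F (shift_index (-2)) (submod_incl N y) = 0.
    by apply/(submod_inclP N); exists y.
  by exists x; apply: (@submod_incl_inj _ _ N); rewrite pP xP.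
Qed.

Lemma flat_retract (M F : lmodType R) (i : {linear M -> F})
    (r : {linear F -> M}) :
  (forall m, r (i m) = m) -> flat F -> flat M.
Proof.
move=> ri flatF; apply: rchar_injective_flat => A B k inj_k f.
have [g gP] := flat_rchar_injective flatF inj_k (rchar_map r \o f).
exists (rchar_map i \o g) => a; apply: charP => m.
by rewrite /= gP /= ri.
Qed.

End Core.

Theorem proposition3p2 (R : pzRingType) (hR : right_coherent R) :
  forall M : lmodType R,
    core (@gorenstein_flat R) (@gorenstein_cotorsion R) M <->
    core (@flat R) (@cotorsion R) M.
Proof.
move=> M; split=> [[gfM gcM]|[flatM cotM]]; last first.
  split; first exact: flat_gorenstein_flat.
  exact: flat_cotorsion_gorenstein_cotorsion.
have [F [N [i [p [flatF gfN inj_i exip sp]]]]] := gorenstein_flat_cosyzygy gfM.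
have [r ri] := Ext1_eq0_split (gcM N gfN) inj_i exip sp.
split; first exact: flat_retract ri flatF.
by move=> G flatG; apply/gcM/flat_gorenstein_flat.
Qed.
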